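(* Let $a$ and $b$ be integers $\ge 2$. Then the hook+column part of the iterated plethysm $s_2\circ s_b\circ s_a$ is $$\left.\left(s_2\circ s_b\circ s_a\right)\right|_{\mathrm{h+c}}=\sum_{k=0}^{2b-1}\min\{k+1,\,2b-k\}\; s_{(2ab-2k,\,2^{k})}+\sum_{k=1}^{2b-3}\min\left\{\left\lfloor\tfrac{k+1}{2}\right\rfloor,\left\lfloor\tfrac{2b-1-k}{2}\right\rfloor\right\}\; s_{(2ab-2k-1,\,2^{k},\,1)}.$$
   Context: Let $\Lambda=\mathbb{Q}[p_1,p_2,\dots]$ be the algebra of symmetric functions, with power sums $p_k$ and Schur functions $s_\lambda$; for a positive integer $n$, $s_n=s_{(n)}$. The plethysm $\circ:\Lambda\times\Lambda\to\Lambda$ is the operation determined by: $p_n\circ p_m=p_{nm}$; for each $f\in\Lambda$ the map $g\mapsto g\circ f$ is an algebra homomorphism; and $p_n\circ f=f\circ p_n$ for all $f$ and $n$ (so $p_n\circ f$ is obtained from $f$ by replacing each $p_m$ by $p_{nm}$). Plethysm is associative, so iterated plethysms need no parentheses. A partition is a hook+column partition if it is of the form $(\alpha,2^\beta,1^\gamma)$ (first part $\alpha$, followed by $\beta$ parts equal to $2$ and $\gamma$ parts equal to $1$). Here $\alpha$ is always the first part, and it may be equal to $1$ or $2$ (so for example $(1^5)=(1,2^0,1^4)$ and $(2^2,1)=(2,2^1,1^1)$). For $f=\sum_\lambda a_\lambda s_\lambda$, the hook+column part is $\left.(f)\right|_{\mathrm{h+c}}=\sum a_\lambda s_\lambda$,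 the sum being over the hook+column partitions $\lambda$ only. *)

(* Defs.v *)
From HB Require Import structures.
From mathcomp Require Import all_boot all_order all_algebra.
From mathcomp.finmap Require Import finmap.
From mathcomp.multinomials Require Import monalg.
From Stdlib Require Import ClassicalEpsilon.

Set Implicit Arguments.
Unset Strict Implicit.
Unset Printing Implicit Defensive.

Import GRing.Theory.

Local Open Scope ring_scope.

(* Lambda = Q[p_1, p_2, ...]: the index i : nat stands for the variable
   p_(i+1).  As a consequence, [psum n] is p_n only for n > 0. *)
Notation symf := {malg rat[{cmonom nat}]}.

Definition psum (n : nat) : symf := << ucm n.-1 >>.

(* Substitution p_(i+1) |-> h i. *)
Definition msubst (h : nat -> symf) (m : {cmonom nat}) : symf :=
  \prod_(i <- finsupp m) h i ^+ m i.

Definition psubst (h : nat -> symf) (f : symf) : symf :=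
  mmap (fun c : rat => c%:A) (msubst h) f.

(* p_n o f, for n > 0 *)
Definition adams (n : nat) (f : symf) : symf :=
  psubst (fun i => psum (n * i.+1)) f.

Definition plethysm (f g : symf) : symf :=
  psubst (fun i => adams i.+1 g) f.

(* The following facts show that [plethysm] satisfies the properties which
   determine the plethysm. *)

Lemma msubstEw h (d : {fset nat}) (m : {cmonom nat}) :
  (finsupp m `<=` d)%fset -> msubst h m = \prod_(i <- d) h i ^+ m i.
Proof.
move=> le; rewrite /msubst (big_fset_incl _ le) // => i _ /fsfun_dflt ->.
by rewrite expr0.
Qed.

Lemma msubst_is_mmorphism h : mmorphism (msubst h).
Proof.
split=> [m1 m2|]; last first.
  by rewrite (@msubstEw h fset0) ?big_seq_fset0 //; apply/fsubsetP=> i;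
     rewrite mem_finsupp onecmE.
pose d := (finsupp m1 `|` finsupp m2 `|` finsupp (mulcm m1 m2))%fset.
have le1 : (finsupp m1 `<=` d)%fset by rewrite /d -fsetUA fsubsetUl.
have le2 : (finsupp m2 `<=` d)%fset by rewrite /d fsetUAC fsubsetUr.
have le3 : (finsupp (mulcm m1 m2) `<=` d)%fset by rewrite /d fsubsetUr.
rewrite (msubstEw h le1) (msubstEw h le2) (msubstEw h le3) -big_split /=.
by apply: eq_bigr => i _; rewrite mulcmE exprD.
Qed.

HB.instance Definition _ h := isMultiplicative.Build _ _ (msubst h)
  (msubst_is_mmorphism h).

Lemma psubst_is_linear h : linear (psubst h).
Proof.
move=> c f g; rewrite /psubst (raddfD (mmap (in_alg symf) (msubst h))) /=.
by rewrite (mmapZ (f := in_alg symf)) /= mulr_algl.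
Qed.

Lemma psubst_is_monoid_morphism h : monoid_morphism (psubst h).
Proof.
by split=> [|f g]; rewrite /psubst ?(rmorph1 (mmap (in_alg symf) (msubst h)))
  ?(rmorphM (mmap (in_alg symf) (msubst h))).
Qed.

HB.instance Definition _ h := GRing.isLinear.Build rat symf symf _ (psubst h)
  (psubst_is_linear h).
HB.instance Definition _ h := GRing.isMonoidMorphism.Build symf symf (psubst h)
  (psubst_is_monoid_morphism h).

Lemma psubst_psum h n : psubst h (psum n) = h n.-1.
Proof.
rewrite /psubst /psum (mmapU (f := in_alg symf)) /= scale1r mul1r.
rewrite (@msubstEw h [fset n.-1]%fset) ?big_seq_fset1 ?ucmE ?eqxx ?expr1 //.
by apply/fsubsetP=> i; rewrite mem_finsupp ucmE inE (eq_sym i); case: (_ == i).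
Qed.

Lemma eq_psubst h h' f : h =1 h' -> psubst h f = psubst h' f.
Proof.
move=> eqh; rewrite /psubst /mmap; apply: eq_bigr => m _.
suff -> : msubst h m = msubst h' m by [].
by apply: eq_bigr => i _; rewrite eqh.
Qed.

Lemma plethysm_psumM n m : (0 < n)%N -> (0 < m)%N ->
  plethysm (psum n) (psum m) = psum (n * m).
Proof.
by case: n m => [|n] [|m] // _ _; rewrite /plethysm /adams !psubst_psum.
Qed.

Lemma plethysm_is_algebra_morphism f :
  linear (plethysm^~ f) * monoid_morphism (plethysm^~ f).
Proof.
exact: (psubst_is_linear _, psubst_is_monoid_morphism _).
Qed.

Lemma plethysm_psumC n f : (0 < n)%N ->
  plethysm (psum n) f = plethysm f (psum n).
Proof.
move=> n_gt0; rewrite /plethysm [LHS]psubst_psum (prednK n_gt0).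
apply: eq_psubst => i; rewrite /adams [RHS]psubst_psum (prednK n_gt0).
by rewrite mulnC.
Qed.

(* h_n is the sum of p_mu / z_mu over the partitions mu of n; here m i is the
   multiplicity of i+1 in mu. *)
Definition hsym (n : nat) : symf :=
  \sum_(m : {ffun 'I_n -> 'I_n.+1} | (\sum_(i < n) i.+1 * m i == n)%N)
    (\prod_(i < n) (i.+1 ^ m i * (m i)`!))%N%:R^-1 *:
      \prod_(i < n) psum i.+1 ^+ m i.

(* Jacobi-Trudi: s_l = det (h_(l_i - i + j)), with h_r = 0 for r < 0. *)
Definition schur (l : seq nat) : symf :=
  \det (\matrix_(i < size l, j < size l)
    if (i <= nth 0%N l i + j)%N then hsym (nth 0%N l i + j - i) else 0).

Definition is_part (s : seq nat) := sorted geq s && (0%N \notin s).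

Record intpart := IntPart { parts :> seq nat; _ : is_part parts }.

HB.instance Definition _ := [isSub for parts].
HB.instance Definition _ := [Choice of intpart by <:].

Definition is_hc (s : seq nat) : bool :=
  if s is _ :: t then t == nseq (count_mem 2%N t) 2%N ++ nseq (count_mem 1%N t) 1%N
  else false.

Lemma is_hcP (s : seq nat) :
  reflect (exists alpha beta gamma,
             s = alpha :: nseq beta 2%N ++ nseq gamma 1%N)
          (is_hc s).
Proof.
case: s => [|a t]; first by constructor => -[? [? []]].
apply: (iffP eqP) => [{1}->|[_ [b [c [_ ->]]]]].
  by exists a, (count_mem 2%N t), (count_mem 1%N t).
by rewrite !count_cat !count_nseq /= !mul1n !mul0n addn0.
Qed.

Definition schur_sum (P : pred intpart) (a : {malg rat[intpart]}) : symf :=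
  \sum_(l <- msupp a | P l) a@_l *: schur l.

(* The coefficients a_l of f = sum_l a_l s_l; they are unique, as the Schur
   functions form a basis of Lambda. *)
Definition schur_coef (f : symf) : {malg rat[intpart]} :=
  epsilon (inhabits 0) (fun a => f = schur_sum predT a).

Definition hc_part (f : symf) : symf :=
  schur_sum (fun l => is_hc l) (schur_coef f).

(* Main.v *)
Require Import Defs.
From mathcomp Require Import all_boot all_order all_algebra.
From mathcomp.finmap Require Import finmap.
From mathcomp.multinomials Require Import monalg.
From mathcomp Require Import fingroup perm ring zify.
From Stdlib Require Import ClassicalEpsilon.

Set Implicit Arguments.
Unset Strict Implicit.
Unset Printing Implicit Defensive.

Import GRing.Theory.

Local Open Scope ring_scope.

(** Hook+column partitions are exactly the nonempty partitions with second part
    at most 2, that is, those which fit into the hook with one arm and two legs.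
    They are therefore detected by the supersymmetric specialization [spec x y z]
    of Lambda in one even variable x and two odd variables y and z, which sends
    p_n to x^n - y^n - z^n (with the odd variables negated, so that the Adams
    operations just raise x, y and z to the n-th power).  It kills s_l as soon
    as l_2 >= 3 ([spec_schur_fat]); and s_(a, 2^b, 1^c) goes, for a >= 2, to
      x^(a-2) (x-y)(x-z) (yz)^b (-1)^c h_c(y,z)
    ([spec_schur_long]).  The images of the remaining Schur functions are
    linearly independent, because for x = t^(N^2), y = t^N, z = t with N large
    they are polynomials in t of pairwise distinct degrees.  Since the Schur
    functions span Lambda ([schur_spanning]), any combination of hook+column
    Schur functions with the same specializations as f is the hook+column part
    of f ([hc_part_eq]), and the theorem becomes an identity between polynomials
    in x, y, z.

    On the left-hand side, the complete functions are specialized by means of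
    Newton's identities, which determine them from the power sums.  The
    specialization of p_n o s_a is A^n - B^n - C^n + D^n for the monomials
    A = x^a, B = x^(a-1) y, C = x^(a-1) z, D = x^(a-2) yz; as BC = AD, the
    generating function of s_b o s_a collapses ([hsum_four]) to
      G(x,y,z) = x^((a-2)b) (x-y)(x-z) Q(x^2, yz),
    where Q(P,U) is the sum of the monomials of degree b-1 in P and U, and
    s_2 o s_b o s_a has specialization (G(x,y,z)^2 + G(x^2,y^2,z^2)) / 2.  As
    (x -+ y)(x -+ z) = (P + U) -+ x(y + z) for P = x^2 and U = yz, twice this is
      x^(2(a-2)b) (x-y)(x-z)
        [(P+U) (Q(P,U)^2 + Q(P^2,U^2)) - x(y+z) (Q(P,U)^2 - Q(P^2,U^2))].
    The two summands are the two sums of the theorem: their coefficients are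
    computed in [geosum_form] and [geodiff_form], by induction on b. *)

(** * Newton's identities *)
Section Newton.

Variable A : comAlgType rat.
Implicit Types p h : nat -> A.

Definition newton_at p h (n : nat) : Prop :=
  n%:R *: h n = \sum_(i < n) p i * h (n - i.+1)%N.

(** In characteristic 0, Newton's identities compute [h n] from earlier values; the
    bound N allows for sequences which satisfy them only up to a truncation. *)
Lemma newton_unique N p h h' :
    (forall n, (n <= N)%N -> newton_at p h n) ->
    (forall n, (n <= N)%N -> newton_at p h' n) ->
  h 0%N = h' 0%N -> forall n, (n <= N)%N -> h n = h' n.
Proof.
move=> hN hN' h0; elim/ltn_ind=> -[//|n] IHn leN.
have n1_neq0 : n.+1%:R != 0 :> rat by rewrite Num.Theory.pnatr_eq0.
apply: (scalerI n1_neq0).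
rewrite [LHS]hN // [RHS]hN' //; apply: eq_bigr => i _.
by rewrite IHn // subSS ?ltnS ?leq_subr // (leq_trans (leq_subr _ _)) // ltnW.
Qed.

(** The complete homogeneous function with power sums p_1, p_2, ... given by
    [p 0], [p 1], ...; [hsym] is the case of the generic power sums. *)
Definition hsum p (n : nat) : A :=
  \sum_(m : {ffun 'I_n -> 'I_n.+1} | (\sum_(i < n) i.+1 * m i == n)%N)
    (\prod_(i < n) (i.+1 ^ m i * (m i)`!))%N%:R^-1 *: \prod_(i < n) p i ^+ m i.

(** The exponential of p_(i+1) t^(i+1) / (i+1), truncated after the power N.  The
    product of these exponentials over all i is the generating function of the
    complete functions. *)
Definition trunc_exp p (N i : nat) : {poly A} :=
  \sum_(m < N.+1) ((i.+1 ^ m * m`!)%N%:R^-1 *: p i ^+ m) *: 'X^(i.+1 * m).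

Lemma hsum_coef p N : hsum p N = (\prod_(i < N) trunc_exp p N i)`_N.
Proof.
rewrite /trunc_exp bigA_distr_bigA /= /hsum.
under [in RHS]eq_bigr => f _ do
  rewrite scaler_prod prodrXr scaler_prod prodfV -natr_prod.
rewrite (coef_sumMXn _ (fun=> true)) /=.
by apply: eq_bigl => f; rewrite eq_sym.
Qed.

(** The truncated exponential satisfies the differential equation of the
    exponential up to its last term, which has degree greater than N. *)
Lemma trunc_exp_deriv p N i :
  exists c : A, 'X * (trunc_exp p N i)^`() =
    (p i *: 'X^(i.+1)) * trunc_exp p N i - c *: 'X^(i.+1 * N.+1).
Proof.
pose t m : A := (i.+1 ^ m * m`!)%N%:R^-1 *: p i ^+ m.
exists (p i * t N).
have tS m : t m.+1 *+ (i.+1 * m.+1) = p i * t m.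
  rewrite /t exprS -scalerAr -scaler_nat scalerA; congr (_ *: _).
  rewrite expnS factS.
  have -> : (i.+1 * i.+1 ^ m * (m.+1 * m`!) = (i.+1 * m.+1) * (i.+1 ^ m * m`!))%N.
    by rewrite mulnACA.
  by rewrite [X in _ / X]natrM invfM mulrA divff ?mul1r // Num.Theory.pnatr_eq0.
rewrite /trunc_exp raddf_sum /= mulr_sumr big_ord_recl muln0.
rewrite derivZ derivXn mulr0n scaler0 mulr0 add0r.
rewrite mulr_sumr [in RHS]big_ord_recr /= -!/(t _).
have scX (u v : A) k l : u *: 'X^k * (v *: 'X^l) = (u * v) *: 'X^(k + l).
  by rewrite -scalerAl -scalerAr scalerA exprD.
rewrite scX -mulnS addrK; apply: eq_bigr => m _.
rewrite -/(t m) -/(t (bump 0 m)) scX -mulnS derivZ derivXn /bump leq0n add1n.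
rewrite -scalerAr mulrnAr -exprS prednK ?muln_gt0 //.
by rewrite -scalerMnr scalerMnl -tS.
Qed.

Lemma prod_trunc_exp_deriv p N K :
  exists Q : {poly A}, 'X * (\prod_(i < K) trunc_exp p N i)^`() =
    (\sum_(i < K) p i *: 'X^(i.+1)) * \prod_(i < K) trunc_exp p N i + 'X^(N.+1) * Q.
Proof.
elim: K => [|K [Q IH]].
  by exists 0; rewrite !big_ord0 mul0r mulr0 -(polyC1 A) derivC mulr0 addr0.
rewrite !big_ord_recr /= derivM mulrDr mulrA IH.
have [c tE] := trunc_exp_deriv p N K.
set P := \prod_(i < K) _; set S := \sum_(i < K) _; set T := trunc_exp p N K.
have -> : 'X * (P * T^`()) = P * ('X * T^`()) by ring.
rewrite tE -/T mulSn exprD.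
exists (Q * T - (c *: 'X^(K * N.+1)) * P).
rewrite -!mul_polyC; ring.
Qed.

Lemma prod_trunc_exp_newton p N n : (n <= N)%N ->
  newton_at p (fun n => (\prod_(i < N) trunc_exp p N i)`_n) n.
Proof.
move=> leN; have [Q /(congr1 (fun P : {poly A} => P`_n))] := prod_trunc_exp_deriv p N N.
set P := \prod_(i < N) _.
rewrite /newton_at coefXM coef_deriv coefD coefXnM ltnS leN addr0 mulr_suml coef_sum.
have -> : (if n == 0%N then 0 else P`_n.-1.+1 *+ n.-1.+1) = P`_n *+ n.
  by case: n leN.
rewrite scaler_nat => ->.
rewrite (big_ord_widen N (fun i => p i * P`_(n - i.+1))) // [RHS]big_mkcond /=.
apply: eq_bigr => i _; rewrite -scalerAl coefZ coefXnM ltnS.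
by case: ltnP => _; rewrite ?mulr0.
Qed.

Lemma trunc_exp0 p N i : (trunc_exp p N i)`_0 = 1.
Proof.
rewrite /trunc_exp big_ord_recl coefD coef_sum big1 ?addr0 => [|m _].
  by rewrite muln0 !expr0 alg_polyC coefC /= invr1 scale1r.
by rewrite coefZ coefXn /= mulr0.
Qed.

Lemma hsum0 p : hsum p 0 = 1.
Proof. by rewrite hsum_coef big_ord0 coef1. Qed.

(** Truncation at N is harmless in degrees at most N: there the truncated
    products for different N satisfy the same recursion, hence agree. *)
Lemma newton_hsum p n : newton_at p (hsum p) n.
Proof.
have hE i : (i <= n)%N -> hsum p i = (\prod_(j < n) trunc_exp p n j)`_i.
  move=> le_in; rewrite hsum_coef.
  apply: (newton_unique (N := i) (p := p)
    (h := fun k => (\prod_(j < i) trunc_exp p i j)`_k)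
    (h' := fun k => (\prod_(j < n) trunc_exp p n j)`_k)) => //.
  - by move=> k; apply: prod_trunc_exp_newton.
  - by move=> k le_ki; apply: prod_trunc_exp_newton; apply: leq_trans le_in.
  - by rewrite !coef0_prod !big1 // => j _; rewrite trunc_exp0.
rewrite /newton_at hE // [LHS](prod_trunc_exp_newton p (leqnn n)).
by apply: eq_bigr => i _; rewrite hE // leq_subr.
Qed.

(** Newton's identity solved for the last power sum: power sums are polynomials in
    complete functions. *)
Lemma newton_psum p n :
  p n = (-1) *: \sum_(i < n) p i * hsum p (n - i) + n.+1%:R *: hsum p n.+1.
Proof.
rewrite (newton_hsum p n.+1) big_ord_recr /= subnn hsum0 mulr1 scaleN1r.
by rewrite addKr.
Qed.

Lemma hsum_unique p h : h 0%N = 1 -> (forall n, newton_at p h n) ->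
  hsum p =1 h.
Proof.
move=> h0 hN n; apply: (newton_unique (N := n) (p := p)) => // [m _|].
- exact: newton_hsum.
- by rewrite hsum0 h0.
Qed.

(** Subtracting the powers of w from the power sums multiplies the generating
    function of the complete functions by 1 - w t. *)
Lemma hsum_sub p w n :
  hsum (fun i => p i - w ^+ i.+1) n.+1 = hsum p n.+1 - w * hsum p n.
Proof.
pose h n := hsum p n - w * (if n is m.+1 then hsum p m else 0).
apply: (hsum_unique (h := h)) => [|[|k]]; rewrite /h ?hsum0 ?mulr0 ?subr0 //.
  by rewrite /newton_at big_ord0 scale0r.
have hN := newton_hsum p; rewrite /newton_at in hN *.
rewrite scalerBr hN.
have -> : \sum_(i < k.+1) (p i - w ^+ i.+1) *
  (hsum p (k.+1 - i.+1) - w * (if (k.+1 - i.+1)%N is m.+1 then hsum p m else 0))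
  = \sum_(i < k.+1) p i * hsum p (k.+1 - i.+1)
  - w * \sum_(i < k) p i * hsum p (k - i.+1)
  - w * hsum p k.
  (* The powers of w contribute a telescoping sum. *)
  rewrite big_ord_recr /= subnn mulr0 subr0 hsum0 mulr1.
  rewrite [in RHS]big_ord_recr /= subnn hsum0 mulr1.
  have -> : \sum_(i < k) (p i - w ^+ i.+1) *
    (hsum p (k.+1 - i.+1) - w * (if (k.+1 - i.+1)%N is m.+1 then hsum p m else 0))
  = \sum_(i < k) p i * hsum p (k.+1 - i.+1)
  - w * \sum_(i < k) p i * hsum p (k - i.+1)
  - (\sum_(i < k) (w ^+ i.+1 * hsum p (k - i)%N - w ^+ i.+2 * hsum p (k - i.+1)%N)).
    rewrite mulr_sumr -!sumrB; apply: eq_bigr => i _.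
    rewrite subSS.
    have -> : (k - i = (k - i.+1).+1)%N by have := ltn_ord i; lia.
    move: (hsum p _.+1) (hsum p (k - _)) => u v.
    by rewrite [w ^+ i.+2]exprS; ring.
  suff -> : \sum_(i < k) (w ^+ i.+1 * hsum p (k - i)%N - w ^+ i.+2 * hsum p (k - i.+1)%N)
    = w * hsum p k - w ^+ k.+1 by ring.
  pose f i := - (w ^+ i.+1 * hsum p (k - i)%N).
  rewrite (eq_bigr (fun i : 'I_k => f i.+1 - f i)) => [|i _].
    rewrite -(big_mkord predT (fun i => f i.+1 - f i)) telescope_sumr //.
    by rewrite /f subnn subn0 hsum0 mulr1 expr1 opprK addrC.
  by rewrite /f opprK addrC.
by rewrite -(hN k) -natr1 scalerDl scale1r scalerAr opprD addrA.
Qed.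

Lemma hsum_powers w : hsum (fun i => w ^+ i.+1) =1 (fun n => w ^+ n).
Proof.
apply: hsum_unique => // n; rewrite /newton_at.
rewrite (eq_bigr (fun=> w ^+ n)) => [|i _].
  by rewrite sumr_const card_ord scaler_nat.
by rewrite -exprD subnKC.
Qed.

Lemma eq_hsum p p' : p =1 p' -> hsum p =1 hsum p'.
Proof.
move=> eqp n; apply: eq_bigr => m _; congr (_ *: _).
by apply: eq_bigr => i _; rewrite eqp.
Qed.

End Newton.

Lemma hsymE n : hsym n = hsum (fun i => psum i.+1) n.
Proof. by []. Qed.

(** * The specialization with one even and two odd variables *)

Lemma psubst_hsym h n : psubst h (hsym n) = hsum h n.
Proof.
rewrite hsymE rmorph_sum; apply: eq_bigr => m _.
rewrite /= linearZ /=; congr (_ *: _); rewrite rmorph_prod; apply: eq_bigr => i _.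
by rewrite rmorphXn /= psubst_psum.
Qed.

Lemma psubstE h f : psubst h f = \sum_(m <- msupp f) f@_m *: msubst h m.
Proof. by apply: eq_bigr => m _; exact: mulr_algl. Qed.

Lemma psubst_comp h g f :
  psubst h (psubst g f) = psubst (fun i => psubst h (g i)) f.
Proof.
rewrite (psubstE g) [RHS]psubstE rmorph_sum; apply: eq_bigr => m _ /=.
rewrite linearZ /=; congr (_ *: _); rewrite rmorph_prod.
by apply: eq_bigr => i _; rewrite rmorphXn.
Qed.

(** The complete functions of one even variable x and two odd variables, with
    generating function (1 - y t)(1 - z t) / (1 - x t). *)
Definition hookh (R : pzRingType) (x y z : R) (n : nat) : R :=
  match n with
  | 0 => 1
  | 1 => x - y - z
  | m.+2 => x ^+ m * ((x - y) * (x - z))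
  end.

Lemma hsum_hook (A : comAlgType rat) (x y z : A) :
  hsum (fun i => x ^+ i.+1 - y ^+ i.+1 - z ^+ i.+1) =1 hookh x y z.
Proof.
case=> [|[|n]]; first exact: hsum0.
  by rewrite !hsum_sub hsum_powers !hsum0 !mulr1.
by rewrite !hsum_sub !hsum_powers /= !exprS; ring.
Qed.

Definition hooksub (x y z : symf) (i : nat) : symf :=
  x ^+ i.+1 - y ^+ i.+1 - z ^+ i.+1.

Notation spec x y z := (psubst (hooksub x y z)).

Lemma spec_adams x y z n f : (0 < n)%N ->
  spec x y z (adams n f) = spec (x ^+ n) (y ^+ n) (z ^+ n) f.
Proof.
move=> n_gt0.
rewrite /adams.
rewrite [LHS]psubst_comp.
apply: eq_psubst => i.
have ni_gt0 : (0 < n * i.+1)%N by rewrite muln_gt0 n_gt0.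
by rewrite psubst_psum /hooksub (prednK ni_gt0) !exprM.
Qed.

(** By [spec_adams], plethysm by g replaces p_n by the specialization of g at the
    n-th powers, so that nested plethysms can be evaluated from the inside. *)
Lemma spec_plethysm x y z f g :
  spec x y z (plethysm f g) =
  psubst (fun i => spec (x ^+ i.+1) (y ^+ i.+1) (z ^+ i.+1) g) f.
Proof.
rewrite /plethysm [LHS]psubst_comp; apply: eq_psubst => i.
exact: spec_adams.
Qed.

Lemma spec_hsym x y z n : spec x y z (hsym n) = hookh x y z n.
Proof. by rewrite psubst_hsym; apply: hsum_hook. Qed.

Lemma schur_row n : schur [:: n] = hsym n.
Proof. by rewrite /schur det_mx11 mxE /= addn0 subn0. Qed.

(** * Jacobi-Trudi determinants under the specialization *)

Section JacobiTrudi.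

Variable R : comNzRingType.

(** Complete functions of negative degree vanish, hence the default value 0. *)
Definition toep (F : nat -> R) (n m : nat) : R :=
  if (m <= n)%N then F (n - m)%N else 0.

Definition jtmx F (l : nat -> nat) n : 'M[R]_n := \matrix_(i, j) toep F (l i + j) i.

Definition jt F l n : R := \det (jtmx F l n).

Lemma toepS F n m : toep F n.+1 m.+1 = toep F n m.
Proof. by rewrite /toep ltnS subSS. Qed.

Lemma jtmx_minor F l n :
  row' ord0 (col' ord0 (jtmx F l n.+1)) = jtmx F (fun i => l i.+1) n.
Proof. by apply/matrixP=> i j; rewrite !mxE !lift0 addnS toepS. Qed.

Lemma eq_jt F l l' n : (forall i, (i < n)%N -> l i = l' i) -> jt F l n = jt F l' n.
Proof.
by move=> eql; congr (\det _); apply/matrixP=> i j; rewrite !mxE eql.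
Qed.

(** The identity permutation contributes the product of the complete functions of
    the parts. *)
Lemma jt_leibniz F l n :
  jt F l n = \prod_(i < n) F (l i) + \sum_(s : 'S_n | s != 1%g)
    (-1) ^+ s * \prod_(i < n) toep F (l i + s i) i.
Proof.
rewrite /jt /determinant (bigD1 1%g) //= odd_perm1 expr0 mul1r; congr (_ + _).
  by apply: eq_bigr => i _; rewrite mxE perm1 /toep leq_addl addnK.
by apply: eq_bigr => t _; congr (_ * _); apply: eq_bigr => i _; rewrite mxE.
Qed.

Lemma det_row0 n (A : 'M[R]_n.+1) :
  (forall j, A ord0 (lift ord0 j) = 0) ->
  \det A = A ord0 ord0 * \det (row' ord0 (col' ord0 A)).
Proof.
move=> A0; rewrite (expand_det_row _ ord0) big_ord_recl big1 => [|j _].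
  by rewrite addr0 /cofactor expr0 mul1r.
by rewrite A0 mul0r.
Qed.

Lemma jt_row0 F l n : (forall j, F (l 0%N + j.+1)%N = 0) ->
  jt F l n.+1 = F (l 0%N) * jt F (fun i => l i.+1) n.
Proof.
move=> F0; rewrite /jt det_row0 => [|j].
  by rewrite mxE addn0 /toep /= subn0 jtmx_minor.
by rewrite mxE lift0 /toep /= subn0 F0.
Qed.

(** The first row has only two nonzero entries.  The minor of the second one has
    first column (1, 0, ..., 0). *)
Lemma jt_col F n : F 0%N = 1 -> (forall k, F k.+3 = 0) ->
  jt F (fun=> 1%N) n.+2 =
  F 1%N * jt F (fun=> 1%N) n.+1 - F 2%N * jt F (fun=> 1%N) n.
Proof.
move=> F0 F3; rewrite /jt; set A := jtmx _ _ _.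
rewrite (expand_det_row A ord0) !big_ord_recl big1 => [|j _]; last first.
  by rewrite mxE !lift0 /toep /= F3 mul0r.
rewrite addr0 {1}/A mxE /toep /= {1}/A mxE /toep /= /cofactor /= expr0 mul1r.
rewrite expr1 mulN1r mulrN jtmx_minor; congr (_ * _ - _ * _).
rewrite -det_tr det_row0 => [|j].
  rewrite !mxE /= /toep /= F0 mul1r -[RHS]det_tr; congr (\det _).
  by apply/matrixP=> i j; rewrite !mxE /toep /= !add1n !ltnS !subSS.
by rewrite !mxE /toep /=.
Qed.

(** The complete functions of the odd variables alone, with generating function
    (1 - y t)(1 - z t). *)
Definition oddh (y z : R) (n : nat) : R :=
  match n with 0 => 1 | 1 => - (y + z) | 2 => y * z | _ => 0 end.

(** The two generating functions differ by the factor 1 - x t. *)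
Lemma toep_hook x y z n m :
  toep (hookh x y z) n.+1 m - x * toep (hookh x y z) n m = toep (oddh y z) n.+1 m.
Proof.
rewrite /toep; case: ltngtP => [le|gt|->]; last first.
- by rewrite subnn ltnn /= mulr0 subr0.
- by rewrite leqNgt (ltn_trans _ gt) // mulr0 subr0.
rewrite -ltnS le subSn //; case: (n - m)%N => [|[|k]] /=; rewrite ?exprS; ring.
Qed.

(** Subtracting x times the preceding column from every column but the first
    removes the even variable from all these columns. *)
Lemma jt_hook x y z l n :
  jt (hookh x y z) l n.+1 = \det (\matrix_(i < n.+1, j < n.+1)
    if j == 0%N :> nat then toep (hookh x y z) (l i) i
    else toep (oddh y z) (l i + j) i).
Proof.
pose U : 'M[R]_n.+1 := 1%:M - x *: \matrix_(i, j) (i.+1 == j)%:R.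
have U1 : \det U = 1.
  rewrite -det_tr det_trig => [|].
    rewrite big1 // => i _.
    by rewrite !mxE eqxx (gtn_eqF (ltnSn i)) mulr0 subr0.
  apply/is_trig_mxP=> i j ltij; rewrite !mxE.
  have -> : (j == i) = false by apply/eqP=> eji; rewrite eji ltnn in ltij.
  by rewrite gtn_eqF ?mulr0 ?subr0 // ltnS ltnW.
rewrite /jt -[LHS]mulr1 -U1 -det_mulmx; congr (\det _).
rewrite /U mulmxBr mulmx1 -scalemxAr.
apply/matrixP=> i j; rewrite !mxE.
case: j => -[|j] lt_j /=.
  rewrite big1 ?mulr0 ?subr0 ?addn0 // => k _.
  by rewrite !mxE mulr0.
rewrite (bigD1 (Ordinal (ltnW lt_j))) //= !mxE eqxx mulr1 big1 => [|k ne_kj].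
  by rewrite addr0 addnS toep_hook.
rewrite !mxE eqSS; case: eqP => [ekj|_]; last by rewrite mulr0.
by case/eqP: ne_kj; apply: val_inj.
Qed.

(** The complete functions of the odd variables vanish in degree at least 3, so
    that a first row of length at least 2 splits off. *)
Lemma jt_hook_long x y z l n : (2 <= l 0%N)%N ->
  jt (hookh x y z) l n.+1 = hookh x y z (l 0%N) * jt (oddh y z) (fun i => l i.+1) n.
Proof.
move=> l0; rewrite jt_hook det_row0 => [|j].
  rewrite mxE /= /toep /= subn0; congr (_ * _).
  congr (\det _).
  by apply/matrixP=> i j; rewrite !mxE !lift0 /= -/(toep _ _ _) addnS toepS.
by rewrite mxE /= /toep /= subn0 addnS; case: (l 0%N) l0 => [|[|k]].
Qed.

(** Here the matrix of [jt_hook] differs from the matrix in the odd variables only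
    in its upper left entry, by x. *)
Lemma jt_hook_col x y z n :
  jt (hookh x y z) (fun=> 1%N) n.+1 =
  jt (oddh y z) (fun=> 1%N) n.+1 + x * jt (oddh y z) (fun=> 1%N) n.
Proof.
rewrite jt_hook [in RHS]/jt !(expand_det_row _ ord0); set B := \matrix_(i, j) _.
have cofE j : cofactor B ord0 j = cofactor (jtmx (oddh y z) (fun=> 1%N) n.+1) ord0 j.
  congr (_ * \det _); apply/matrixP=> i k; rewrite !mxE.
  case: eqP => //= ->; rewrite addn0 /toep.
  by case: ltnP => //; case: (i : nat).
rewrite !big_ord_recl cofE.
under eq_bigr => i _ do rewrite cofE.
rewrite [X in _ = _ + X + _](eq_bigr (fun i => B ord0 (lift ord0 i) *
   cofactor (jtmx (oddh y z) (fun=> 1%N) n.+1) ord0 (lift ord0 i))); last first.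
  by move=> i _; rewrite !mxE.
rewrite !mxE /= /toep /=.
have -> : cofactor (jtmx (oddh y z) (fun=> 1%N) n.+1) ord0 ord0 =
  jt (oddh y z) (fun=> 1%N) n.
  by rewrite /cofactor expr0 mul1r jtmx_minor.
rewrite -/(jt _ _ n); ring.
Qed.

(** The even variable alone determines the ratios of the complete functions of
    degree at least 2, so the first two rows are proportional. *)
Lemma jt_two_long x y z l n : (3 <= l 1%N <= l 0%N)%N -> jt (hookh x y z) l n.+2 = 0.
Proof.
case/andP=> l1 l01; rewrite /jt; set A := jtmx _ _ _.
pose i1 : 'I_n.+2 := lift ord0 ord0.
pose B : 'M[R]_n.+2 := \matrix_(i, j) if i == ord0 then A i1 j else A i j.
rewrite (@determinant_multilinear _ _ A B B ord0 (x ^+ (l 0%N - l 1%N).+1) 0).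
- rewrite mul0r addr0 (@determinant_alternate _ _ B ord0 i1) ?mulr0 //.
  by move=> j; rewrite !mxE.
- rewrite scale0r addr0; apply/rowP=> j; rewrite !mxE /= /toep subn0.
  have -> : (bump 0 0 <= l 1%N + j)%N by apply: leq_trans (leq_addr _ _); apply: leq_trans l1.
  have -> : (l 0%N + j = ((l 0%N - l 1%N).+1 + (l 1%N - 3 + j)).+2)%N by lia.
  have -> : (l 1%N + j - bump 0 0 = (l 1%N - 3 + j).+2)%N by rewrite /bump; lia.
  by rewrite /= [RHS]mulrA -exprD.
- by apply/matrixP=> i j; rewrite !mxE.
- by apply/matrixP=> i j; rewrite !mxE.
Qed.

(** (-1)^n times the complete function h_n(y,z) of two even variables. *)
Fixpoint oddcomp (y z : R) (n : nat) : R :=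
  if n is m.+1 then - y * oddcomp y z m + (- z) ^+ m.+1 else 1.

Lemma jt_oddh_col y z n : jt (oddh y z) (fun=> 1%N) n = oddcomp y z n.
Proof.
suff [] : jt (oddh y z) (fun=> 1%N) n = oddcomp y z n /\
  jt (oddh y z) (fun=> 1%N) n.+1 = oddcomp y z n.+1 by [].
elim: n => [|n [IH1 IH2]]; split => //.
- by rewrite /jt det_mx00.
- by rewrite /jt det_mx11 mxE /toep /=; ring.
- by rewrite jt_col // IH1 IH2 /= !exprS; ring.
Qed.

Lemma jt_oddh y z b c :
  jt (oddh y z) (nth 0%N (nseq b 2 ++ nseq c 1)) (b + c) = (y * z) ^+ b * oddcomp y z c.
Proof.
elim: b => [|b IHb].
  rewrite mul1r -jt_oddh_col; apply: eq_jt => i lt_ic.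
  by rewrite nth_nseq lt_ic.
by rewrite addSn jt_row0 ?IHb ?exprS ?mulrA.
Qed.

(** The case a <= 1 is that of a single column, where b = 0 is intended. *)
Definition hookval x y z (a b c : nat) : R :=
  if (a <= 1)%N then oddcomp y z c.+1 + x * oddcomp y z c
  else hookh x y z a * ((y * z) ^+ b * oddcomp y z c).

Lemma jt_hookval x y z a b c : (0 < a)%N -> (a == 1)%N ==> (b == 0)%N ->
  jt (hookh x y z) (nth 0%N (a :: nseq b 2 ++ nseq c 1)) (b + c).+1 =
  hookval x y z a b c.
Proof.
move=> a_gt0 a1; rewrite /hookval.
case: leqP => [le_a1|lt_1a]; last by rewrite jt_hook_long // jt_oddh.
have ea1 : a = 1%N by apply/eqP; rewrite eqn_leq le_a1.
move: a1; rewrite ea1 => /implyP/(_ isT)/eqP ->; rewrite add0n.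
rewrite -!jt_oddh_col -jt_hook_col; apply: eq_jt => -[|i] //=.
by rewrite ltnS nth_nseq => ->.
Qed.

End JacobiTrudi.

Lemma schurE l : schur l = jt hsym (nth 0%N l) (size l).
Proof. by []. Qed.

Lemma rmorph_jt (R S : comNzRingType) (f : {rmorphism R -> S}) F l n :
  f (jt F l n) = jt (f \o F) l n.
Proof.
rewrite /jt -det_map_mx; congr (\det _); apply/matrixP=> i j.
by rewrite !mxE /toep; case: ifP => // _; rewrite rmorph0.
Qed.

Lemma spec_schur x y z l :
  spec x y z (schur l) = jt (hookh x y z) (nth 0%N l) (size l).
Proof.
rewrite schurE rmorph_jt /jt; congr (\det _); apply/matrixP=> i j.
by rewrite !mxE /toep; case: ifP => // _; apply: spec_hsym.
Qed.

Lemma spec_schur_fat x y z a b l : (3 <= b <= a)%N ->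
  spec x y z (schur [:: a, b & l]) = 0.
Proof. by move=> le; rewrite spec_schur jt_two_long. Qed.

(** The two conditions on a and b make (a, 2^b, 1^c) a partition. *)
Lemma spec_schur_hc x y z a b c : (0 < a)%N -> (a == 1)%N ==> (b == 0)%N ->
  spec x y z (schur (a :: nseq b 2%N ++ nseq c 1%N)) = hookval x y z a b c.
Proof.
move=> a_gt0 a1; rewrite spec_schur /= size_cat !size_nseq.
exact: jt_hookval.
Qed.

(** * Schur functions span *)

Lemma schur_sumEw (d : {fset intpart}) P (a : {malg rat[intpart]}) :
  (msupp a `<=` d)%fset -> schur_sum P a = \sum_(l <- d | P l) a@_l *: schur l.
Proof.
move=> le_ad; rewrite /schur_sum big_mkcond [RHS]big_mkcond /=.
rewrite (big_fset_incl _ le_ad) // => l _ /mcoeff_outdom al0.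
by rewrite al0 scale0r if_same.
Qed.

Lemma schur_sum_linear P c (a b : {malg rat[intpart]}) :
  schur_sum P (c *: a + b) = c *: schur_sum P a + schur_sum P b.
Proof.
pose d := (msupp a `|` msupp b)%fset.
have le_a : (msupp a `<=` d)%fset by apply: fsubsetUl.
have le_b : (msupp b `<=` d)%fset by apply: fsubsetUr.
have le_ab : (msupp (c *: a + b) `<=` d)%fset.
  apply: fsubset_trans (msuppD_le _ _) _; apply: fsetSU; exact: msuppZ_le.
rewrite (schur_sumEw P le_a) (schur_sumEw P le_b) (schur_sumEw P le_ab).
rewrite scaler_sumr -big_split; apply: eq_bigr => l _ /=.
by rewrite mcoeffD mcoeffZ scalerDl scalerA.
Qed.

Lemma schur_sumU (P : pred intpart) l : P l -> schur_sum P << l >> = schur l.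
Proof.
move=> Pl; rewrite /schur_sum msuppU oner_eq0 big_mkcond big_seq_fset1 Pl.
by rewrite mcoeffUU scale1r.
Qed.

Definition schur_span (P : pred intpart) (f : symf) : Prop :=
  exists a, f = schur_sum P a.

Section SchurSpan.

Variable P : pred intpart.

Lemma schur_span_lin c f g :
  schur_span P f -> schur_span P g -> schur_span P (c *: f + g).
Proof.
by move=> [a ->] [b ->]; exists (c *: a + b); rewrite schur_sum_linear.
Qed.

Lemma schur_span0 : schur_span P 0.
Proof. by exists 0; rewrite /schur_sum msupp0 big_mkcond big_seq_fset0. Qed.

Lemma schur_spanD f g : schur_span P f -> schur_span P g -> schur_span P (f + g).
Proof. by rewrite -{2}[f]scale1r; apply: schur_span_lin. Qed.

Lemma schur_spanZ c f : schur_span P f -> schur_span P (c *: f).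
Proof. by move=> Pf; rewrite -[_ *: _]addr0; apply/schur_span_lin/schur_span0. Qed.

Lemma schur_span_sum I (r : seq I) (Q : pred I) (F : I -> symf) :
  (forall i, Q i -> schur_span P (F i)) -> schur_span P (\sum_(i <- r | Q i) F i).
Proof.
by move=> PF; apply: big_ind PF; [apply: schur_span0 | apply: schur_spanD].
Qed.

Lemma schur_span_schur s (ps : is_part s) : P (IntPart ps) -> schur_span P (schur s).
Proof. by move=> Ps; exists << IntPart ps >>; rewrite schur_sumU. Qed.

End SchurSpan.

Definition hprod (s : seq nat) : symf := \prod_(i <- s) hsym i.

(** With B larger than the number of parts, [wsum] below increases whenever the
    first part of a partition to be changed is enlarged, whatever happens to the
    later parts.  Zero parts do not count. *)
Definition weight (B i : nat) : nat := if i is 0 then 0%N else (B ^ i)%N.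

Definition wsum (B : nat) (s : seq nat) : nat := (\sum_(i <- s) weight B i)%N.

Definition part_of (s : seq nat) := sort geq [seq i <- s | (0 < i)%N].

Lemma part_of_part s : is_part (part_of s).
Proof.
by rewrite /is_part sort_sorted ?mem_sort ?mem_filter // => m n; apply: leq_total.
Qed.

Lemma big_part_of (T : Type) (idx : T) (op : Monoid.com_law idx) (F : nat -> T) s :
  F 0%N = idx -> \big[op/idx]_(i <- part_of s) F i = \big[op/idx]_(i <- s) F i.
Proof.
move=> F0; rewrite /part_of (perm_big _ (permEl (perm_sort _ _))) big_filter.
by rewrite big_mkcond; apply: eq_bigr => -[|i] _; rewrite ?F0.
Qed.

Lemma wsum_le N B s : (\sum_(i <- s) i = N)%N -> (0 < B)%N -> (wsum B s <= N * B ^ N)%N.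
Proof.
move=> sN B_gt0; rewrite -{1}sN big_distrl /= /wsum big_seq [in leqRHS]big_seq.
apply: leq_sum => -[|i] // s_i; rewrite mulSn; apply: leq_trans (leq_addr _ _).
rewrite leq_pexp2l // -sN (perm_big _ (perm_to_rem s_i)) big_cons.
exact: leq_addr.
Qed.

Lemma part_size s : is_part s -> (size s <= \sum_(i <- s) i)%N.
Proof.
case/andP=> _; elim: s => //= i s IHs; rewrite inE negb_or big_cons.
case: i => // i /andP[_ /IHs]; lia.
Qed.

(** All values to the left of the first moved point are already taken. *)
Lemma perm_neq1_first n (s : 'S_n) : s != 1%g ->
  exists2 i : 'I_n, (i < s i)%N & forall j : 'I_n, (j < i)%N -> s j = j.
Proof.
move=> s_neq1; have [i0 si0] : exists i, s i != i.
  apply/existsP; apply: contraNT s_neq1; rewrite negb_exists => /forallP fixs.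
  by apply/eqP/permP=> i; rewrite perm1; apply/eqP; rewrite -[_ == _]negbK.
case: (@arg_minnP _ i0 (fun i => s i != i) (fun i => val i) si0) => i si min_i.
have fix_s (j : 'I_n) : (j < i)%N -> s j = j.
  by move=> lt_ji; apply/eqP; apply: contraLR lt_ji => /min_i; rewrite -leqNgt.
exists i => //; case: ltngtP => // [lt_si|/val_inj/esym/eqP]; last by rewrite (negPf si).
by have /perm_inj/eqP := fix_s _ lt_si; rewrite (negPf si).
Qed.

(** In the Jacobi-Trudi determinant, every nonzero term but the diagonal one has
    larger parts, in the sense of [wsum]: the transition from products of complete
    functions to Schur functions is unitriangular. *)
Lemma wsum_incr N (l : seq nat) (s : 'S_(size l)) :
    is_part l -> (\sum_(i <- l) i = N)%N -> s != 1%g ->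
    (forall i : 'I_(size l), (i <= nth 0%N l i + s i)%N) ->
  (wsum N.+1 l < wsum N.+1 [seq (nth 0 l i + s i - i)%N | i : 'I_(size l)])%N.
Proof.
move=> pl lN s1 les; have [i0 lt_i0 fix_s] := perm_neq1_first s1.
have szl := part_size pl; rewrite lN in szl.
have lP j : (j < size l)%N -> (0 < nth 0 l j)%N.
  move=> ltj; rewrite lt0n; case/andP: pl => _; apply: contraNneq => <-.
  exact: mem_nth.
rewrite /wsum big_map big_enum /= (big_nth 0%N) big_mkord.
rewrite (bigID (fun i : 'I__ => (i < i0)%N)) [ltnRHS](bigID (fun i : 'I__ => (i < i0)%N)) /=.
have -> : (\sum_(i < size l | (i < i0)%N) weight N.+1 (nth 0 l i + s i - i) =
           \sum_(i < size l | (i < i0)%N) weight N.+1 (nth 0 l i))%N.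
  by apply: eq_bigr => i lti; rewrite fix_s // addnK.
rewrite ltn_add2l [ltnRHS](bigD1 i0) ?ltnn //=.
apply: leq_trans (leq_addr _ _).
apply: (@leq_ltn_trans (\sum_(i < size l) N.+1 ^ nth 0 l i0)%N).
  rewrite [leqRHS](bigID (fun i : 'I__ => ~~ (i < i0)%N)) /=.
  apply: leq_trans (leq_addr _ _); apply: leq_sum => i; rewrite -leqNgt => le_i.
  have le_l : (nth 0 l i <= nth 0 l i0)%N.
    have geq_trans : transitive geq by move=> b a c /= ab bc; apply: leq_trans ab.
    case/andP: pl => sl _.
    by apply: (sorted_leq_nth geq_trans leqnn 0%N sl) => //; rewrite inE.
  by rewrite /weight; case: (nth 0 l i) le_l => // k le_k; rewrite leq_pexp2l.
rewrite sum_nat_const card_ord.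
apply: (@leq_trans (N.+1 ^ (nth 0 l i0).+1)%N).
  by rewrite expnS ltn_mul2r expn_gt0 /= ltnS.
have -> : (nth 0 l i0 + s i0 - i0 = (nth 0 l i0 + (s i0 - i0).-1).+1)%N by lia.
by rewrite /weight leq_pexp2l // ltnS leq_addr.
Qed.

(** Downward induction on [wsum], which is bounded in every degree by [wsum_le]:
    solve the expanded determinant for its diagonal term. *)
Lemma schur_span_hprod N s : (\sum_(i <- s) i = N)%N -> schur_span predT (hprod s).
Proof.
have [k] := ubnP (N * N.+1 ^ N - wsum N.+1 s)%N.
elim: k s => // k IHk s le_k sN.
have [l pl [lN lw ->]] : exists2 l, is_part l & [/\ (\sum_(i <- l) i = N)%N,
    wsum N.+1 l = wsum N.+1 s & hprod s = hprod l].
  exists (part_of s); first exact: part_of_part.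
  by rewrite /wsum /hprod !big_part_of // hsymE hsum0.
rewrite -{}lw in le_k; move: s sN => _ _.
have span_l : schur_span predT (schur l) by apply: (schur_span_schur (ps := pl)).
have detE : schur l = hprod l + \sum_(s : 'S_(size l) | s != 1%g)
    (-1) ^+ s * \prod_(i < size l) toep hsym (nth 0%N l i + s i) i.
  by rewrite schurE jt_leibniz /hprod (big_nth 0%N) big_mkord.
have -> : hprod l = schur l + (-1) *: \sum_(s : 'S_(size l) | s != 1%g)
    (-1) ^+ s * \prod_(i < size l) toep hsym (nth 0%N l i + s i) i.
  by rewrite detE scaleN1r addrK.
apply: schur_spanD => //; apply: schur_spanZ; apply: schur_span_sum => t t1.
rewrite -signr_odd mulr_sign; set F := \prod_(i < _) _.
suff spF : schur_span predT F by case: ifP => _; rewrite // -scaleN1r; apply: schur_spanZ.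
have [/forallP le_t|] := boolP [forall i : 'I_(size l), (i <= nth 0 l i + t i)%N]; last first.
  rewrite negb_forall => /existsP[i /negPf i_bad].
  by rewrite /F (bigD1 i) //= /toep i_bad mul0r; apply: schur_span0.
pose a := [seq (nth 0 l i + t i - i)%N | i : 'I_(size l)].
have -> : F = hprod a.
  rewrite /hprod big_map big_enum; apply: eq_bigr => i _.
  by rewrite /toep le_t.
have aN : (\sum_(i <- a) i = N)%N.
  rewrite big_map big_enum /=; apply/eqP.
  rewrite -(eqn_add2r (\sum_(i < size l) i)) -big_split /=.
  rewrite (eq_bigr (fun i : 'I_(size l) => nth 0%N l i + t i)%N) => [|i _]; last first.
    by rewrite subnK.
  rewrite big_split /= -(big_mkord predT (fun i => nth 0%N l i)) -(big_nth 0%N predT id) lN.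
  by rewrite [X in (_ == _ + X)%N](reindex_inj (@perm_inj _ t)).
apply: IHk => //; have := wsum_incr pl lN t1 le_t; rewrite -/a.
have := wsum_le aN (ltn0Sn N); lia.
Qed.

(** The linear span of the products of complete functions, which is in fact all of
    Lambda. *)
Inductive hspan : symf -> Prop :=
| hspan_prod s : hspan (hprod s)
| hspan_lin c f g : hspan f -> hspan g -> hspan (c *: f + g).

Lemma hspan0 : hspan 0.
Proof.
have -> : (0 : symf) = (-1) *: hprod [::] + hprod [::] by rewrite scaleN1r addNr.
by apply: hspan_lin; apply: hspan_prod.
Qed.

Lemma hspanD f g : hspan f -> hspan g -> hspan (f + g).
Proof. by move=> hf hg; rewrite -[f]scale1r; apply: hspan_lin. Qed.

Lemma hspanZ c f : hspan f -> hspan (c *: f).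
Proof. by move=> hf; rewrite -[_ *: _]addr0; apply: hspan_lin => //; apply: hspan0. Qed.

Lemma mul_linl (A : algType rat) c (f1 f2 g : A) :
  (c *: f1 + f2) * g = c *: (f1 * g) + f2 * g.
Proof. by rewrite mulrDl scalerAl. Qed.

Lemma mul_linr (A : algType rat) c (f g1 g2 : A) :
  f * (c *: g1 + g2) = c *: (f * g1) + f * g2.
Proof. by rewrite mulrDr scalerAr. Qed.

Lemma hspanM f g : hspan f -> hspan g -> hspan (f * g).
Proof.
move=> hf hg; elim: hf => [s|c f1 f2 _ IH1 _ IH2].
  elim: hg => [t|c g1 g2 _ IH1 _ IH2].
    by have := hspan_prod (s ++ t); rewrite /hprod big_cat.
  rewrite (mul_linr c (hprod s) g1 g2).
  exact: (hspan_lin c IH1 IH2).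
rewrite (mul_linl c f1 f2 g).
exact: (hspan_lin c IH1 IH2).
Qed.

Lemma hspan_sum I (r : seq I) (Q : pred I) (F : I -> symf) :
  (forall i, Q i -> hspan (F i)) -> hspan (\sum_(i <- r | Q i) F i).
Proof.
by move=> PF; apply: big_ind PF; [apply: hspan0 | apply: hspanD].
Qed.

Lemma hspan_hsym n : hspan (hsym n).
Proof. by have := hspan_prod [:: n]; rewrite /hprod big_seq1. Qed.

Lemma hspan_psum n : hspan (psum n.+1).
Proof.
elim/ltn_ind: n => n IHn.
rewrite (newton_psum (fun i => psum i.+1) n) -hsymE.
apply: hspan_lin; last by apply/hspanZ/hspan_hsym.
by apply: hspan_sum => i _; apply: hspanM; [apply: IHn | apply: hspan_hsym].
Qed.

Lemma hspan_monom (m : {cmonom nat}) : hspan << m >>.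
Proof.
have [k] := ubnP (mdeg m); elim: k m => // k IHk m le_k.
have [/mdeg_eq0I ->|] := eqVneq (mdeg m) 0%N.
  by have := hspan_prod [::]; rewrite /hprod big_nil.
rewrite mdegE => m_neq0.
have [i m_i] : exists i, i \in finsupp m.
  case: (finsupp m =P fset0) => [m0|/eqP/fset0Pn //].
  by rewrite m0 big_seq_fset0 in m_neq0.
pose m' := divcm m (ucm i).
have mE : m = mulcm (ucm i) m'.
  apply/eqP/cmP=> j; rewrite mulcmE /m' divcmE ucmE subnKC //.
  by case: eqP => // <-; rewrite lt0n cmE_neq0.
have -> : << m >> = psum i.+1 * << m' >> :> symf.
  by rewrite /psum malgM_def fgmulUU mulr1 {1}mE.
apply: hspanM; first exact: hspan_psum.
apply: IHk; move: le_k; rewrite mE (mdegM (ucm i) m') (mdegU i) add1n ltnS.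
by [].
Qed.

Lemma malgU_scale (K : choiceType) (c : rat) (k : K) :
  << c *g k >> = c *: << k >> :> {malg rat[K]}.
Proof. by apply/malgP => j; rewrite mcoeffZ !mcoeffU mulrnAr mulr1. Qed.

Lemma schur_spanning f : schur_span predT f.
Proof.
have : hspan f.
  rewrite [f]monalgE; apply: hspan_sum => m _.
  by rewrite malgU_scale; apply: hspanZ; apply: hspan_monom.
elim=> [s|c f1 f2 _ IH1 _ IH2]; last exact: schur_span_lin.
exact: (@schur_span_hprod _ s).
Qed.

(** * Distinct degrees and linear independence *)

Section Degrees.

Variable N : nat.
Hypothesis N_ge2 : (2 <= N)%N.

(** The degree is exactly n; in particular, p is not 0. *)
Definition has_deg (p : {poly rat}) (n : nat) := size p = n.+1.

Lemma has_degM (p q : {poly rat}) m n : has_deg p m -> has_deg q n -> has_deg (p * q) (m + n).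
Proof.
rewrite /has_deg => sp sq; rewrite size_mul -?size_poly_eq0 ?sp ?sq //.
by rewrite addnS.
Qed.

Lemma has_degD (p q : {poly rat}) m : has_deg p m -> (size q <= m)%N -> has_deg (p + q) m.
Proof. by rewrite /has_deg => sp sq; rewrite size_polyDl ?sp. Qed.

Lemma has_degB (p q : {poly rat}) m : has_deg p m -> (size q <= m)%N -> has_deg (p - q) m.
Proof. by move=> sp sq; apply: has_degD; rewrite ?size_polyN. Qed.

Lemma has_degXn n : has_deg 'X^n n.
Proof. by rewrite /has_deg size_polyXn. Qed.

Lemma has_deg_oddcomp c : has_deg (oddcomp 'X^N 'X c) (c * N).
Proof.
elim: c => [|c IHc]; first by rewrite /has_deg size_poly1.
rewrite [oddcomp _ _ _]/=; apply: has_degD.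
  by rewrite mulNr /has_deg size_polyN mulSn; apply: has_degM => //; apply: has_degXn.
rewrite exprNn -signr_odd mulr_sign.
have -> : size (if odd c.+1 then - 'X^(c.+1) else 'X^(c.+1) : {poly rat}) = c.+2.
  by case: ifP => _; rewrite ?size_polyN size_polyXn.
nia.
Qed.

Lemma has_deg_hookh a : (2 <= a)%N -> has_deg (hookh 'X^(N ^ 2) 'X^N 'X a) (a * N ^ 2).
Proof.
case: a => [|[|a]] // _; rewrite [hookh _ _ _ _]/= -exprM.
have -> : (a.+2 * N ^ 2 = N ^ 2 * a + (N ^ 2 + N ^ 2))%N by lia.
have leN : (N < N ^ 2)%N by nia.
apply: has_degM; first exact: has_degXn.
apply: has_degM; apply: has_degB; rewrite ?size_polyXn ?size_polyX //; try exact: has_degXn.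
lia.
Qed.

(** The number (a N + (b + c)) N + b determines a, b + c and b once N exceeds
    b + c. *)
Lemma has_deg_hookval a b c : (0 < a)%N -> (a == 1)%N ==> (b == 0)%N ->
  has_deg (hookval 'X^(N ^ 2) 'X^N 'X a b c) (a * N ^ 2 + (b + c) * N + b).
Proof.
move=> a_gt0 a1; rewrite /hookval; case: leqP => [le_a1|lt_1a].
  have ea1 : a = 1%N by apply/eqP; rewrite eqn_leq le_a1.
  move: a1; rewrite ea1 => /implyP/(_ isT)/eqP ->.
  rewrite addrC addn0 add0n mul1n; apply: has_degD.
    by apply: has_degM; [apply: has_degXn | apply: has_deg_oddcomp].
  rewrite has_deg_oddcomp; nia.
have -> : (a * N ^ 2 + (b + c) * N + b = a * N ^ 2 + (N.+1 * b + c * N))%N by lia.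
apply: has_degM; first exact: has_deg_hookh.
apply: has_degM; last exact: has_deg_oddcomp.
by rewrite -exprSr -exprM; apply: has_degXn.
Qed.

End Degrees.

Lemma sorted_twos_ones t : sorted geq t -> all (fun i => (0 < i <= 2)%N) t ->
  t = nseq (count_mem 2%N t) 2%N ++ nseq (count_mem 1%N t) 1%N.
Proof.
elim: t => //= -[|[|[|i]]] t IHt //= t_sorted t_le2; last first.
  by rewrite {1}IHt // (path_sorted t_sorted).
have geq_trans : transitive geq by move=> b a c /= ab bc; apply: leq_trans ab.
have /all_pred1P -> : all (pred1 1%N) t.
  have /allP t_le1 := order_path_min geq_trans t_sorted.
  apply/allP=> i t_i; move/allP/(_ _ t_i): t_le2 => /andP[i_gt0 _].
  by rewrite /= eqn_leq i_gt0 andbT; apply: t_le1.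
by rewrite !count_nseq /= add0n mul1n.
Qed.

(** The partitions whose Schur functions survive the specialization: besides the
    hook+column partitions, this includes the empty partition. *)
Definition thin (l : seq nat) : bool := is_hc l || (l == [::]).

Lemma thin_hook (l : seq nat) : is_part l -> is_hc l ->
  exists a b c, [/\ l = a :: nseq b 2%N ++ nseq c 1%N, (0 < a)%N
    & (a == 1)%N ==> (b == 0)%N].
Proof.
move=> /andP[l_sorted l_pos] /is_hcP[a [b [c le]]].
exists a, b, c; split=> //; first by move: l_pos; rewrite le inE negb_or lt0n eq_sym => /andP[].
apply/implyP=> /eqP ea; move: l_sorted; rewrite le ea.
by case: b {le}.
Qed.

Lemma not_thin (l : seq nat) : is_part l -> ~~ thin l ->
  exists a b t, l = [:: a, b & t] /\ (3 <= b <= a)%N.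
Proof.
case/andP; case: l => [|a [|b t]] //= /andP[le_ba t_sorted] l_pos not_hc.
exists a, b, t; split=> //; rewrite le_ba andbT ltnNge; apply: contra not_hc => b_le2.
rewrite /thin orbF /is_hc; apply/eqP; apply: sorted_twos_ones => //.
have geq_trans : transitive geq by move=> i j k /= ij jk; apply: leq_trans ij.
have /allP t_leb := order_path_min geq_trans t_sorted.
apply/allP=> i i_bt; apply/andP; split.
  rewrite lt0n; apply: contraNneq l_pos => i0.
  by rewrite inE; move: i_bt; rewrite i0 => ->; rewrite orbT.
move: i_bt; rewrite inE => /predU1P[-> //|/t_leb le_ib].
exact: leq_trans le_ib b_le2.
Qed.

(** The degree in [has_deg_hookval], expressed by the partition itself. *)
Definition top_deg (N : nat) (l : seq nat) : nat :=
  (head 0 l * N ^ 2 + (size l).-1 * N + count_mem 2 (behead l))%N.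

Lemma top_deg_hook N a b c :
  top_deg N (a :: nseq b 2 ++ nseq c 1) = (a * N ^ 2 + (b + c) * N + b)%N.
Proof.
by rewrite /top_deg /= size_cat count_cat !size_nseq !count_nseq mul1n mul0n addn0.
Qed.

Lemma top_deg_inj N (l m : seq nat) :
    is_part l -> is_part m -> thin l -> thin m ->
    (size l < N)%N -> (size m < N)%N -> top_deg N l = top_deg N m ->
  l = m.
Proof.
move=> pl pm /orP[hl|/eqP->] /orP[hm|/eqP->] //.
- have [a [b [c [-> a0 _]]]] := thin_hook pl hl.
  have [a' [b' [c' [-> a0' _]]]] := thin_hook pm hm.
  rewrite !top_deg_hook /= !size_cat !size_nseq => lt lt' e.
  have e1 : ((a * N + (b + c)) * N + b = (a' * N + (b' + c')) * N + b')%N by lia.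
  have N_gt0 : (0 < N)%N by apply: leq_trans lt.
  have eb : b = b'.
    have := congr1 (modn^~ N) e1; rewrite !modnMDl !modn_small //; lia.
  have e2 : (a * N + (b + c) = a' * N + (b' + c'))%N.
    by apply/eqP; rewrite -(eqn_pmul2r N_gt0) -(eqn_add2r b) {3}eb; apply/eqP.
  have ebc : (b + c = b' + c')%N.
    have := congr1 (modn^~ N) e2; rewrite !modnMDl !modn_small //; lia.
  have ea : a = a'.
    by apply/eqP; rewrite -(eqn_pmul2r N_gt0) -(eqn_add2r (b + c)) {2}ebc; apply/eqP.
  have ec : c = c' by lia.
  by rewrite ea eb ec.
- have [a [b [c [-> a0 _]]]] := thin_hook pl hl.
  rewrite top_deg_hook /top_deg /= !mul0n => lt _; nia.
- have [a [b [c [-> a0 _]]]] := thin_hook pm hm.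
  rewrite top_deg_hook /top_deg /= !mul0n => _ lt; nia.
Qed.

(** Downward induction on the size: the leading term of the largest polynomial
    cannot be cancelled. *)
Lemma poly_free (I : eqType) (r : seq I) (P : pred I) (q : I -> {poly rat})
    (c : I -> rat) : uniq r ->
    (forall i, i \in r -> P i -> q i != 0) ->
    (forall i j, i \in r -> j \in r -> P i -> P j -> size (q i) = size (q j) -> i = j) ->
    \sum_(i <- r | P i) c i *: q i = 0 ->
  forall i, i \in r -> P i -> c i = 0.
Proof.
move=> r_uniq q_neq0 q_inj sum0 i r_i P_i.
pose M := \max_(j <- r) size (q j).
have le_M j : j \in r -> (size (q j) <= M)%N by move=> r_j; apply: leq_bigmax_seq.
have [k] := ubnP (M - size (q i))%N.
elim: k i r_i P_i => // k IHk i r_i P_i le_k.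
have /eqP := congr1 (fun p : {poly rat} => p`_(size (q i)).-1) sum0.
rewrite coef_sum coef0 (big_rem i) //= P_i big_seq_cond big1 => [|j].
  rewrite addr0 coefZ mulf_eq0 => /orP[/eqP //|].
  by rewrite [_ == 0]lead_coef_eq0 (negPf (q_neq0 _ r_i P_i)).
case/andP; rewrite mem_rem_uniq // inE => /andP[ne_ji r_j] P_j; rewrite coefZ.
case: (ltngtP (size (q i)) (size (q j))) => [lt|lt|/esym eq].
- rewrite (IHk j) ?mul0r //; have := le_M j r_j; lia.
- by rewrite nth_default ?mulr0 // -ltnS (ltn_predK lt).
- by rewrite (q_inj _ _ r_j r_i P_j P_i eq) eqxx in ne_ji.
Qed.

Lemma rmorph_jt_hookh (R S : comNzRingType) (f : {rmorphism R -> S}) x y z l n :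
  f (jt (hookh x y z) l n) = jt (hookh (f x) (f y) (f z)) l n.
Proof.
rewrite rmorph_jt /jt; congr (\det _); apply/matrixP=> i j.
rewrite !mxE /toep; case: ifP => // _; case: (_ - _)%N => [|[|k]] /=.
- by rewrite rmorph1.
- by rewrite !rmorphB.
- by rewrite !(rmorphM, rmorphB, rmorphXn).
Qed.

Lemma horner_alg_sum (A : algType rat) (t : A) (p : {poly rat}) :
  horner_alg t p = \sum_(i < size p) p`_i *: t ^+ i.
Proof.
rewrite -{1}[p]coefK poly_def rmorph_sum; apply: eq_bigr => i _.
by rewrite /= linearZ /= rmorphXn /= horner_algX mulr_algl.
Qed.

Definition p1pow (i : nat) : {cmonom nat} := iter i (mulcm (ucm 0)) (onecm nat).

Lemma psum1X i : psum 1 ^+ i = << p1pow i >>.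
Proof.
elim: i => [|i IHi]; first by [].
rewrite [LHS]exprS IHi.
rewrite malgM_def.
rewrite /psum fgmulUU mulr1.
by congr << _ >>.
Qed.

Lemma p1pow_inj : injective p1pow.
Proof.
have p0 i : p1pow i 0%N = i.
  by elim: i => [|i IHi]; rewrite /= ?onecmE // mulcmE ucmE IHi.
by move=> i j eij; rewrite -[i]p0 eij p0.
Qed.

Lemma malg_coef_sum (K : choiceType) n (c : nat -> rat) (m : nat -> K) j :
  injective m -> (j < n)%N ->
  (\sum_(i < n) c i *: << m i >> : {malg rat[K]})@_(m j) = c j.
Proof.
move=> m_inj lt_jn; rewrite raddf_sum (bigD1 (Ordinal lt_jn)) //= big1 => [|i ne_ij].
  by rewrite mcoeffZ mcoeffU eqxx mulr1 addr0.
rewrite mcoeffZ mcoeffU (inj_eq m_inj).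
by rewrite (_ : (i == j :> nat) = false) ?mulr0 //; apply/negbTE.
Qed.

(** The powers of p_1 are distinct monomials of Lambda.  This turns Lambda itself
    into a target for specializations at powers of one variable t = p_1. *)
Lemma psum1_free p : horner_alg (psum 1) p = 0 -> p = 0.
Proof.
rewrite horner_alg_sum => p0; apply/polyP=> j; rewrite coef0.
have [lt_j|] := ltnP j (size p); last exact: nth_default.
rewrite -(malg_coef_sum (fun i => p`_i) p1pow_inj lt_j).
under eq_bigr => i _ do rewrite -psum1X.
by rewrite p0 mcoeff0.
Qed.

(** * The hook+column part is determined by the specializations *)

Definition hpoly (N : nat) (l : seq nat) : {poly rat} :=
  jt (hookh 'X^(N ^ 2) 'X^N 'X) (nth 0%N l) (size l).

Lemma size_hpoly N (l : seq nat) : (2 <= N)%N -> is_part l -> thin l ->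
  size (hpoly N l) = (top_deg N l).+1.
Proof.
move=> N2 pl /orP[hl|/eqP->]; last by rewrite /hpoly /jt det_mx00 size_poly1 /top_deg.
have [a [b [c [-> a_gt0 a1]]]] := thin_hook pl hl.
rewrite top_deg_hook /hpoly /= size_cat !size_nseq jt_hookval //.
exact: has_deg_hookval.
Qed.

Lemma spec_schur_hpoly N (l : seq nat) (ev := horner_alg (psum 1)) : is_part l ->
  spec (ev 'X^(N ^ 2)) (ev 'X^N) (ev 'X) (schur l) =
  if thin l then ev (hpoly N l) else 0.
Proof.
move=> pl; case: ifPn => [_|/(not_thin pl)[a [b [t [-> le]]]]].
  by rewrite spec_schur; exact/esym/rmorph_jt_hookh.
exact: spec_schur_fat.
Qed.

Lemma horner_algZ (A : algType rat) (t : A) c (p : {poly rat}) :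
  horner_alg t (c *: p) = c *: horner_alg t p.
Proof. by rewrite linearZ /= mulr_algl. Qed.

Lemma sum_scale_diff (V : lmodType rat) (I : Type) (d : seq I) (P Q : pred I)
    (q : I -> V) (a r : I -> rat) : (forall i, Q i -> P i) ->
    \sum_(i <- d) a i *: (if P i then q i else 0) =
    \sum_(i <- d | Q i) r i *: (if P i then q i else 0) ->
  \sum_(i <- d | P i) (a i - (if Q i then r i else 0)) *: q i = 0.
Proof.
move=> QP eq_ar; pose F i := a i *: (if P i then q i else 0).
pose G i := if Q i then r i *: (if P i then q i else 0) else 0.
transitivity (\sum_(i <- d) (F i - G i)); last first.
  by rewrite sumrB [X in X - _]eq_ar [X in X - _]big_mkcond subrr.
rewrite big_mkcond; apply: eq_bigr => i _; rewrite /F /G.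
have := QP i; case: (P i) => [_|not_Q].
  by case: (Q i); [rewrite scalerBl | rewrite !subr0].
by case: (Q i) not_Q => [/(_ isT)|_] //; rewrite scaler0 subr0.
Qed.

Lemma horner_alg_free (I : Type) (d : seq I) (P Q : pred I)
    (q : I -> {poly rat}) (a r : I -> rat) (ev := horner_alg (psum 1)) :
    (forall i, Q i -> P i) ->
    \sum_(i <- d) a i *: (if P i then ev (q i) else 0) =
    \sum_(i <- d | Q i) r i *: (if P i then ev (q i) else 0) ->
  \sum_(i <- d | P i) (a i - (if Q i then r i else 0)) *: q i = 0.
Proof.
move=> QP /(sum_scale_diff QP) sum0; apply: psum1_free; rewrite -[RHS]sum0 rmorph_sum.
by apply: eq_bigr => i _; apply: horner_algZ.
Qed.

Lemma spec_schur_sum N (d : seq intpart) P (c : intpart -> rat)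
    (ev := horner_alg (psum 1)) :
  spec (ev 'X^(N ^ 2)) (ev 'X^N) (ev 'X) (\sum_(l <- d | P l) c l *: schur l) =
  \sum_(l <- d | P l) c l *: (if thin l then ev (hpoly N l) else 0).
Proof.
rewrite raddf_sum; apply: eq_bigr => l _.
have pl : is_part l by case: l.
by rewrite -(spec_schur_hpoly N pl); apply: linearZ.
Qed.

(** The coefficients of f and g at hook+column partitions agree, by independence of
    the specializations.  The coefficient at the empty partition has to be carried
    along in the relation. *)
Lemma hc_part_eq f g : schur_span (fun l => is_hc l) g ->
  (forall x y z, spec x y z f = spec x y z g) -> hc_part f = g.
Proof.
case=> r -> spec_fg; rewrite /hc_part; set a := schur_coef f.
have fE : f = schur_sum predT a.
  exact: epsilon_spec (inhabits 0) (fun a => f = schur_sum predT a) (schur_spanning f).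
pose d := (msupp a `|` msupp r)%fset.
have le_a : (msupp a `<=` d)%fset by apply: fsubsetUl.
have le_r : (msupp r `<=` d)%fset by apply: fsubsetUr.
rewrite fE (schur_sumEw _ le_a) (schur_sumEw _ le_r) in spec_fg.
rewrite (schur_sumEw _ le_a) (schur_sumEw _ le_r).
(* N has to be at least 2 and to exceed the number of parts of each l in d. *)
pose N := (\max_(l <- d) size l).+2.
have lt_N (l : intpart) : l \in d -> (size l < N)%N.
  by move=> d_l; rewrite ltnS ltnW // ltnS; apply: leq_bigmax_seq.
have intpartP (l : intpart) : is_part l by case: l.
pose ev := horner_alg (psum 1).
have sum0 := etrans (esym (spec_schur_sum N d predT (fun l => a@_l)))
  (etrans (spec_fg (ev 'X^(N ^ 2)) (ev 'X^N) (ev 'X))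
    (spec_schur_sum N d (fun l => is_hc l) (fun l => r@_l))).
have hc_thin (l : intpart) : is_hc l -> thin l by rewrite /thin => ->.
have {}sum0 := horner_alg_free hc_thin sum0.
have e0 := poly_free (fset_uniq d) _ _ sum0.
rewrite [LHS]big_seq_cond [RHS]big_seq_cond.
apply: eq_bigr => l /andP[d_l hl].
suff eq_l : a@_l = r@_l by rewrite eq_l.
apply/eqP; rewrite -subr_eq0; apply/eqP.
have := e0 _ _ l d_l; rewrite hl; apply.
- by move=> i d_i thin_i; rewrite -size_poly_eq0 size_hpoly.
- move=> i j d_i d_j thin_i thin_j; rewrite !size_hpoly // => -[eq_deg].
  by apply/val_inj/(top_deg_inj _ _ thin_i thin_j _ _ eq_deg) => //; apply: lt_N.
- by rewrite /thin hl.
Qed.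

(** * Squares of geometric sums in two variables *)

Section BinaryForms.

Variable R : comNzRingType.

(** The sum of all monomials of degree n - 1 in P and U. *)
Fixpoint geo (P U : R) (n : nat) : R :=
  if n is m.+1 then P ^+ m + U * geo P U m else 0.

Lemma geoS (P U : R) n : geo P U n.+1 = P ^+ n + U * geo P U n.
Proof. by []. Qed.

Lemma geoSr (P U : R) n : geo P U n.+1 = P * geo P U n + U ^+ n.
Proof.
elim: n => [|n IHn]; first by rewrite /= !mulr0 !expr0 add0r addr0.
by rewrite geoS {1}IHn geoS !exprS; ring.
Qed.

Lemma geo_mulD (P U : R) n :
  (P + U) * geo P U n.+1 = geo P U n.+2 + P * U * geo P U n.
Proof. by rewrite (geoS P U n.+1) mulrDl {1}(geoS P U n) exprS; ring. Qed.

Lemma geo_scale c (P U : R) n : geo (c * P) (c * U) n.+1 = c ^+ n * geo P U n.+1.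
Proof.
elim: n => [|n IHn]; first by rewrite /= !mulr0 addr0 !expr0 mulr1.
by rewrite geoS IHn (geoS P U n.+1) exprMn (exprS c); ring.
Qed.

Lemma geoD (P U : R) m n : geo P U (m + n) = P ^+ m * geo P U n + U ^+ n * geo P U m.
Proof.
elim: n => [|n IHn]; first by rewrite addn0 /= mulr0 add0r mul1r.
by rewrite addnS geoS IHn geoS exprD exprS; ring.
Qed.

Lemma geo_double (P U : R) n :
  geo P U (2 * n) = (P + U) * geo (P ^+ 2) (U ^+ 2) n.
Proof.
elim: n => [|n IHn]; first by rewrite /= mulr0.
have -> : (2 * n.+1 = (2 * n).+2)%N by lia.
by rewrite !geoS IHn exprS -!exprM; ring.
Qed.

Variables P U : R.

(** The homogeneous polynomial of degree n - 1 in P and U whose coefficient at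
    U^k is [f k]. *)
Definition form (f : nat -> nat) (n : nat) : R :=
  \sum_(k < n) (f k)%:R * (P ^+ (n.-1 - k) * U ^+ k).

Lemma eq_form f g n : (forall k, (k < n)%N -> f k = g k) -> form f n = form g n.
Proof. by move=> eq_fg; apply: eq_bigr => k _; rewrite eq_fg. Qed.

(** Without its two extreme coefficients, a form is P U times a shorter one.  The
    coefficient sequences of [geosum_form] and [geodiff_form] are reproduced in
    this way, up to adding 1 to every coefficient, when n decreases by 1 and by 2,
    respectively. *)
Lemma form_ends f n : form f n.+2 =
  (f 0%N)%:R * P ^+ n.+1 + P * U * form (fun k => f k.+1) n + (f n.+1)%:R * U ^+ n.+1.
Proof.
rewrite /form big_ord_recr big_ord_recl /= subn0 subnn expr0 mulr1 mul1r.
congr (_ + _ + _); rewrite mulr_sumr; apply: eq_bigr => k _.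
rewrite /bump leq0n add1n subSS exprS.
have -> : (n - k = (n.-1 - k).+1)%N by have := ltn_ord k; lia.
by rewrite exprS; ring.
Qed.

Lemma form_const1 n : form (fun=> 1%N) n = geo P U n.
Proof.
suff [] : form (fun=> 1%N) n = geo P U n /\ form (fun=> 1%N) n.+1 = geo P U n.+1 by [].
elim: n => [|n [IH1 IH2]]; split=> //.
- by rewrite /form big_ord0.
- by rewrite /form big_ord1 /= !mulr0 !mulr1 addr0.
- by rewrite form_ends IH1 geoS geoSr !exprS; ring.
Qed.

Lemma formS f n : form (fun k => (f k).+1) n = form f n + geo P U n.
Proof.
rewrite -form_const1 /form -big_split; apply: eq_bigr => k _ /=.
by rewrite -natr1 mulrDl.
Qed.

Definition geosum n : R := geo P U n ^+ 2 + geo (P ^+ 2) (U ^+ 2) n.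
Definition geodiff n : R := geo P U n ^+ 2 - geo (P ^+ 2) (U ^+ 2) n.

Lemma geo_sqr n : geo P U n.+1 ^+ 2 =
  P * U * geo P U n ^+ 2 + geo P U (2 * n).+1.
Proof.
have -> : ((2 * n).+1 = n.+1 + n)%N by lia.
rewrite geoD exprS expr1 {1}geoSr !geoS !exprS.
move: (geo P U n) (P ^+ n) (U ^+ n) => g p u; ring.
Qed.

Lemma geo_even n : geo (P ^+ 2) (U ^+ 2) n.+1 =
  geo P U (2 * n).+1 - P * U * geo (P ^+ 2) (U ^+ 2) n.
Proof. by rewrite !geoS geo_double -!exprM; ring. Qed.

(** The squares g_n of [geo P U n] satisfy g_(n+1) = P U g_n + geo P U (2n+1), and
    [geo (P^2) (U^2) n] satisfies the same recursion with - P U in place of P U.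
    Hence [geosum] and [geodiff] are exchanged at every step, and their formulas
    are proved by inductions with step 2. *)
Lemma geosumS n : geosum n.+1 = P * U * geodiff n + 2%:R * geo P U (2 * n).+1.
Proof. by rewrite /geosum /geodiff geo_sqr geo_even; ring. Qed.

Lemma geodiffS n : geodiff n.+1 = P * U * geosum n.
Proof. by rewrite /geosum /geodiff geo_sqr geo_even; ring. Qed.

Lemma geosum_form n :
  (P + U) * geosum n = 2%:R * form (fun k => minn (k + 1) (2 * n - k)) (2 * n).
Proof.
suff [] : (P + U) * geosum n =
      2%:R * form (fun k => minn (k + 1) (2 * n - k)) (2 * n) /\
    (P + U) * geosum n.+1 =
      2%:R * form (fun k => minn (k + 1) (2 * n.+1 - k)) (2 * n.+1) by [].
have formSS m : form (fun k => minn (k + 1) (2 * m.+1 - k)) (2 * m.+1) =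
    P * U * form (fun k => minn (k + 1) (2 * m - k)) (2 * m) + geo P U (2 * m).+2.
  have -> : (2 * m.+1 = (2 * m).+2)%N by lia.
  rewrite form_ends.
  rewrite (eq_form (g := fun k => (minn (k + 1) (2 * m - k)).+1)) => [|k lt_k]; last by lia.
  rewrite formS.
  have -> : minn (0 + 1) ((2 * m).+2 - 0) = 1%N by lia.
  have -> : minn ((2 * m).+1 + 1) ((2 * m).+2 - (2 * m).+1) = 1%N by lia.
  by rewrite geoS geoSr !exprS; ring.
elim: n => [|n [IH1 IH2]]; split=> //.
- by rewrite /geosum /form big_ord0 /= expr0n addr0 !mulr0.
- rewrite formSS geosumS /geodiff /form muln0 big_ord0 /=; ring.
rewrite geosumS geodiffS formSS mulrDr.
have -> : (P + U) * (P * U * (P * U * geosum n)) =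
  P * U * (P * U * ((P + U) * geosum n)) by ring.
rewrite IH1 formSS.
have -> : (P + U) * (2%:R * geo P U (2 * n.+1).+1) =
  2%:R * (geo P U (2 * n.+1).+2 + P * U * geo P U (2 * n.+1)).
  by rewrite -geo_mulD mulrCA.
have -> : (2 * n.+1 = (2 * n).+2)%N by lia.
ring.
Qed.

Lemma geodiff_form n :
  geodiff n.+1 =
  2%:R * form (fun k => minn ((k + 1) %/ 2) ((2 * n.+1 - 1 - k) %/ 2)) (2 * n).+1.
Proof.
pose F n := form (fun k => minn ((k + 1) %/ 2) ((2 * n.+1 - 1 - k) %/ 2)) (2 * n).+1.
suff [] : geodiff n.+1 = 2%:R * F n /\ geodiff n.+2 = 2%:R * F n.+1 by [].
elim: n => [|n [IH1 IH2]]; split=> //.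
- rewrite /F (eq_form (g := fun=> 0%N)) => [|[|k] //].
  by rewrite /form big_ord1 geodiffS /geosum /=; ring.
- rewrite /F (eq_form (g := fun k => nat_of_bool (k == 1%N))) => [|[|[|[|k]]] //].
  by rewrite form_ends /form big_ord1 !geodiffS /geosum /=; ring.
rewrite geodiffS geosumS mulrDr IH1.
have -> : F n.+2 = P * U * (P * U * F n + geo P U (2 * n.+1).+1).
  rewrite /F.
  have -> : ((2 * n.+2).+1 = (2 * n).+3.+2)%N by lia.
  rewrite form_ends form_ends.
  rewrite (eq_form (g := fun k =>
    (minn ((k + 1) %/ 2) ((2 * n.+1 - 1 - k) %/ 2)).+1)) => [|k lt_k]; last by lia.
  rewrite formS.
  have -> : minn ((0 + 1) %/ 2) ((2 * n.+3 - 1 - 0) %/ 2) = 0%N by lia.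
  have -> : minn ((1 + 1) %/ 2) ((2 * n.+3 - 1 - 1) %/ 2) = 1%N by lia.
  have -> : minn (((2 * n).+2.+1 + 1) %/ 2) ((2 * n.+3 - 1 - (2 * n).+2.+1) %/ 2) = 1%N by lia.
  have -> : minn (((2 * n).+3.+1 + 1) %/ 2) ((2 * n.+3 - 1 - (2 * n).+3.+1) %/ 2) = 0%N by lia.
  have -> : (2 * n.+1 = (2 * n).+2)%N by lia.
  rewrite (geoS P U (2 * n).+2) (geoSr P U (2 * n).+1) !exprS.
  ring.
ring.
Qed.

End BinaryForms.

(** * The iterated plethysm *)

Section Plethysm.

Variable A : comAlgType rat.

(** The generating function is (1 - b t)(1 - c t) / ((1 - a t)(1 - d t)).  In the
    presence of b c = a d its numerator is
    (1 - a t)(1 - d t) + (a + d - b - c) t. *)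
Lemma hsum_four (a b c d : A) n : b * c = a * d ->
  hsum (fun i => a ^+ i.+1 - b ^+ i.+1 - c ^+ i.+1 + d ^+ i.+1) n.+1 =
  (a + d - b - c) * geo a d n.+1.
Proof.
move=> bc_ad; set p := (p in hsum p).
have step m : hsum p m.+1 = hookh a b c m.+1 + d * hsum p m.
  rewrite -hsum_hook -[LHS](subrK (d * hsum p m)); congr (_ + _).
  by rewrite -hsum_sub; apply: eq_hsum => i; rewrite /p addrK.
elim: n => [|n IHn]; rewrite step.
  by rewrite hsum0 /=; ring.
rewrite IHn [hookh _ _ _ _]/= [in RHS]geoS.
have -> : (a - b) * (a - c) = a * (a + d - b - c).
  by rewrite !mulrBl !mulrBr bc_ad; ring.
by rewrite exprS; ring.
Qed.

(** The value of s_b o s_a, for c = (a - 2) b. *)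
Definition innerval (x y z : A) c b : A :=
  x ^+ c * ((x - y) * (x - z)) * geo (x ^+ 2) (y * z) b.

Lemma hsum_hookh (x y z : A) a b :
  hsum (fun i => hookh (x ^+ i.+1) (y ^+ i.+1) (z ^+ i.+1) a.+2) b.+1 =
  innerval x y z (a * b.+1) b.+1.
Proof.
pose q := x ^+ a.
rewrite (eq_hsum (p' := fun i => (q * x ^+ 2) ^+ i.+1 - (q * x * y) ^+ i.+1 -
    (q * x * z) ^+ i.+1 + (q * (y * z)) ^+ i.+1)) => [|i].
  rewrite hsum_four; last by ring.
  by rewrite geo_scale /innerval mulnS exprD exprM -/q; ring.
rewrite [hookh _ _ _ _]/= (exprAC x i.+1 a) -/q !exprMn.
move: (q ^+ _) (x ^+ i.+1) (y ^+ i.+1) (z ^+ i.+1) => r u v w; ring.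
Qed.

(** This is the identity s_2 = (p_1^2 + p_2) / 2. *)
Lemma hsum2 (p : nat -> A) : 2%:R *: hsum p 2 = p 0%N ^+ 2 + p 1%N.
Proof.
have h1 : hsum p 1 = p 0%N.
  have := newton_hsum p 1; rewrite /newton_at scale1r => ->.
  by rewrite big_ord1 subnn hsum0 mulr1.
have := newton_hsum p 2; rewrite /newton_at => ->.
by rewrite !big_ord_recl big_ord0 /= h1 hsum0 addr0 mulr1 expr2.
Qed.

Lemma hsum2_innerval (x y z : A) c b :
  2%:R *: hsum (fun i => innerval (x ^+ i.+1) (y ^+ i.+1) (z ^+ i.+1) c b) 2 =
  innerval x y z c b ^+ 2 + innerval (x ^+ 2) (y ^+ 2) (z ^+ 2) c b.
Proof. by rewrite hsum2 !expr1. Qed.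

Lemma hookval_long (x y z : A) a b c :
  hookval x y z a.+2 b c = x ^+ a * ((x - y) * (x - z)) * ((y * z) ^+ b * oddcomp y z c).
Proof. by []. Qed.

(** The factors (x -+ y)(x -+ z) are P + U -+ x (y + z) for P = x^2, U = y z, which
    separates the partitions without a part 1 from those with one part 1. *)
Lemma innerval_hook (x y z : A) a b (c := (a * b.+1)%N) :
  innerval x y z c b.+1 ^+ 2 + innerval (x ^+ 2) (y ^+ 2) (z ^+ 2) c b.+1 =
  2%:R * (\sum_(0 <= k < 2 * b.+1) (minn (k + 1) (2 * b.+1 - k))%:R *
            hookval x y z (2 * a.+2 * b.+1 - 2 * k) k 0
    + \sum_(1 <= k < 2 * b.+1 - 2) (minn ((k + 1) %/ 2) ((2 * b.+1 - 1 - k) %/ 2))%:R *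
            hookval x y z (2 * a.+2 * b.+1 - 2 * k - 1) k 1).
Proof.
have cE : (2 * a.+2 * b.+1 = 2 * c + 4 * b.+1)%N by rewrite /c; lia.
clearbody c.
pose P := x ^+ 2; pose U := y * z.
pose W := x ^+ c ^+ 2 * ((x - y) * (x - z)).
have S1 : \sum_(0 <= k < 2 * b.+1) (minn (k + 1) (2 * b.+1 - k))%:R *
            hookval x y z (2 * a.+2 * b.+1 - 2 * k) k 0 =
    W * form P U (fun k => minn (k + 1) (2 * b.+1 - k)) (2 * b.+1).
  rewrite big_mkord mulr_sumr; apply: eq_bigr => k _.
  have -> : (2 * a.+2 * b.+1 - 2 * k = (c * 2 + 2 * ((2 * b.+1).-1 - k)).+2)%N.
    by have := ltn_ord k; lia.
  rewrite hookval_long exprD !exprM /W /P /U [oddcomp _ _ _]/=.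
  by move: (_ ^+ (_ - _)) (_ ^+ k) (x ^+ c) => u v w; ring.
have S2 : \sum_(1 <= k < 2 * b.+1 - 2)
      (minn ((k + 1) %/ 2) ((2 * b.+1 - 1 - k) %/ 2))%:R *
            hookval x y z (2 * a.+2 * b.+1 - 2 * k - 1) k 1 =
    - (W * x * (y + z) * form P U
      (fun k => minn ((k + 1) %/ 2) ((2 * b.+1 - 1 - k) %/ 2)) (2 * b).+1).
  pose F k := (minn ((k + 1) %/ 2) ((2 * b.+1 - 1 - k) %/ 2))%:R *
     hookval x y z (2 * a.+2 * b.+1 - 2 * k - 1) k 1.
  (* The coefficients at k = 0 and k = 2 b vanish; they complete the sum to a form. *)
  transitivity (\sum_(0 <= k < (2 * b).+1) F k).
    have F0 k : minn ((k + 1) %/ 2) ((2 * b.+1 - 1 - k) %/ 2) = 0%N -> F k = 0.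
      by rewrite /F => ->; rewrite mul0r.
    have -> : (2 * b.+1 - 2 = 2 * b)%N by lia.
    rewrite big_nat_recr //= F0; last by lia.
    rewrite addr0; case: (2 * b)%N => [|m]; first by rewrite !big_geq.
    rewrite [RHS]big_ltn // F0 ?add0r //; lia.
  rewrite big_mkord mulr_sumr -sumrN; apply: eq_bigr => k _; rewrite /F.
  have -> : (2 * a.+2 * b.+1 - 2 * k - 1 = (c * 2 + (2 * (2 * b - k)).+1).+2)%N.
    by have := ltn_ord k; lia.
  rewrite hookval_long exprD exprS !exprM /W /P /U [oddcomp _ _ _]/= [(2 * b).+1.-1]/=.
  by move: (_ ^+ (_ - _)) (_ ^+ k) (x ^+ c) => u v w; ring.
rewrite S1 S2 mulrDr mulrN mulrCA -geosum_form.
have := geodiff_form P U b; set D := form _ _ _ _ => Dd.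
have -> : 2%:R * (W * x * (y + z) * D) = W * x * (y + z) * (2%:R * D) by ring.
rewrite -Dd /geosum /geodiff /innerval -exprM mulnC exprM -exprMn /W.
rewrite -/P -/U.
move: (geo P U b.+1) (geo (P ^+ 2) (U ^+ 2) b.+1) => g g2; rewrite /P /U.
ring.
Qed.

End Plethysm.

Lemma is_part_hc a b c : (2 <= a)%N -> is_part (a :: nseq b 2%N ++ nseq c 1%N).
Proof.
move=> a2; apply/andP; split; last first.
  by rewrite inE mem_cat !mem_nseq !andbF orbF; case: a a2.
have ones : path geq 2 (nseq c 1%N) by elim: c => [|[|c] IHc].
have twos : path geq 2 (nseq b 2 ++ nseq c 1)%N by elim: b => [|b IHb].
case: b twos => [_|b /= ->]; last by rewrite andbT.
by case: c ones => [|c] //= ->; rewrite andbT ltnW.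
Qed.

Lemma schur_span_hc a b c : (2 <= a)%N ->
  schur_span (fun l => is_hc l) (schur (a :: nseq b 2%N ++ nseq c 1%N)).
Proof.
move=> a2; apply: (schur_span_schur (ps := is_part_hc b c a2)).
by apply/is_hcP; exists a, b, c.
Qed.

Lemma spec_schur_long x y z a b c : (2 <= a)%N ->
  spec x y z (schur (a :: nseq b 2%N ++ nseq c 1%N)) = hookval x y z a b c.
Proof.
by move=> a2; apply: spec_schur_hc; case: a a2 => [|[|a]].
Qed.

Lemma spec_iterated x y z a b :
  2%:R *: spec x y z (plethysm (schur [:: 2%N])
            (plethysm (schur [:: b.+1]) (schur [:: a.+2]))) =
  innerval x y z (a * b.+1) b.+1 ^+ 2 +
  innerval (x ^+ 2) (y ^+ 2) (z ^+ 2) (a * b.+1) b.+1.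
Proof.
have inner u v w : spec u v w (plethysm (schur [:: b.+1]) (schur [:: a.+2])) =
    innerval u v w (a * b.+1) b.+1.
  rewrite spec_plethysm (schur_row b.+1) psubst_hsym -hsum_hookh; apply: eq_hsum => i.
  by rewrite schur_row; apply: spec_hsym.
rewrite [spec x y z _]spec_plethysm (schur_row 2) psubst_hsym.
have -> : hsum (fun i => spec (x ^+ i.+1) (y ^+ i.+1) (z ^+ i.+1)
      (plethysm (schur [:: b.+1]) (schur [:: a.+2]))) 2 =
    hsum (fun i => innerval (x ^+ i.+1) (y ^+ i.+1) (z ^+ i.+1) (a * b.+1) b.+1) 2.
  by apply: eq_hsum => i; exact: inner.
exact: hsum2_innerval.
Qed.

Lemma mul_nat_scale (A : algType rat) n (u : A) : n%:R * u = n%:R *: u.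
Proof. by rewrite scaler_nat mulr_natl. Qed.

Lemma spec_schur_term x y z n a b c : (2 <= a)%N ->
  spec x y z (n%:R *: schur (a :: nseq b 2%N ++ nseq c 1%N)) =
  n%:R * hookval x y z a b c.
Proof.
move=> a2; rewrite -(spec_schur_long x y z b c a2) [RHS]mul_nat_scale.
exact: linearZ.
Qed.

Theorem mainTheorem1 (a b : nat) (ha : (2 <= a)%N) (hb : (2 <= b)%N) :
  hc_part (plethysm (schur [:: 2%N]) (plethysm (schur [:: b]) (schur [:: a])))
  = \sum_(0 <= k < 2 * b)
      (minn (k + 1) (2 * b - k))%:R *:
        schur ((2 * a * b - 2 * k)%N :: nseq k 2%N)
  + \sum_(1 <= k < 2 * b - 2)
      (minn ((k + 1) %/ 2) ((2 * b - 1 - k) %/ 2))%:R *: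
        schur ((2 * a * b - 2 * k - 1)%N :: nseq k 2%N ++ [:: 1%N]).
Proof.
case: a b ha hb => [|[|a]] [|b] // _ _.
have row1 k : (k < 2 * b.+1)%N -> (2 <= 2 * a.+2 * b.+1 - 2 * k)%N by nia.
have row2 k : (k < 2 * b.+1 - 2)%N -> (2 <= 2 * a.+2 * b.+1 - 2 * k - 1)%N by nia.
apply: hc_part_eq => [|x y z].
  apply: schur_spanD; rewrite big_seq; apply: schur_span_sum => k;
    rewrite mem_index_iota => /andP[_ lt_k]; apply: schur_spanZ.
    by rewrite -[nseq k _]cats0; apply: (schur_span_hc k 0 (row1 k lt_k)).
  exact: (schur_span_hc k 1 (row2 k lt_k)).
have two_neq0 : 2%:R != 0 :> rat by [].
apply: (scalerI two_neq0).
apply: etrans (spec_iterated x y z a b) _.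
apply: etrans (innerval_hook x y z a b) _.
apply: etrans (mul_nat_scale _ _) _; congr (_ *: _).
apply: esym; apply: etrans (raddfD _ _ _) _.
congr (_ + _); rewrite [LHS]raddf_sum.
  rewrite [LHS]big_seq [RHS]big_seq; apply: eq_bigr => k.
  rewrite mem_index_iota => /andP[_ lt_k].
  by rewrite -[nseq k _]cats0; apply: (spec_schur_term _ _ _ _ k 0 (row1 k lt_k)).
rewrite [LHS]big_seq [RHS]big_seq; apply: eq_bigr => k.
rewrite mem_index_iota => /andP[_ lt_k].
exact: (spec_schur_term _ _ _ _ k 1 (row2 k lt_k)).
Qed.
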